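(* There is a constant $C > 0$ such that for each $p \in (0,1)$ the following holds. For any graph $G$ with $n = |V(G)|$ vertices and maximum degree $\Delta$, almost surely \[ \frac{\lambda_{\max}(G_p)}{-\lambda_{\min}(G_p)} \;\geq\; \frac{\lambda_{\max}(G) - (C/p)\left(\sqrt{\Delta} + \sqrt{\log n}\right)}{-\lambda_{\min}(G) + (C/p)\left(\sqrt{\Delta} + \sqrt{\log n}\right)}. \] In particular, almost surely \[ \chi(G_p) \;\geq\; \frac{\lambda_{\max}(G)}{-\lambda_{\min}(G) + (C/p)\left(\sqrt{\Delta} + \sqrt{\log n}\right)}. \]
   Context: Graphs are finite and simple. For a graph $G$ and $p\in[0,1]$, $G_p$ denotes the random subgraph of $G$ on the vertex set $V(G)$ obtained by keeping each edge of $G$ independently with probability $p$. $\chi$ denotes the chromatic number. For a graph $H$, $\lambda_{\max}(H)$ and $\lambda_{\min}(H)$ are the largest and smallest eigenvalues of the adjacency matrix of $H$ (the $0/1$ matrix indexed by $V(H)$ with $(u,v)$-entry $1$ iff $u$ and $v$ are adjacent). ''Almost surely'' means with probability tending to $1$ as $n = |V(G)| \to \infty$: that is, for fixed $p$ and for every sequence of graphs $G$ with $|V(G)|\to\infty$, the probability of the stated event tends to $1$; the constant $C$ is universal (independent of $p$ and of $G$). If $G_p$ has no edges, so that both of its extreme eigenvalues are $0$, the ratio $0/0$ on the left-hand side of the first inequality is interpreted as $0$. *)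

(* Defs.v *)
(* MathComp / MathComp-Analysis *)
From HB Require Import structures.
From mathcomp Require Import all_boot all_order all_algebra.
From mathcomp Require Import all_classical all_reals all_analysis.

Set Implicit Arguments.
Unset Strict Implicit.
Unset Printing Implicit Defensive.

Import Order.TTheory GRing.Theory Num.Theory.
Local Open Scope ring_scope.

Record sgraph : Type := SGraph {
  vertex : finType;
  adj : rel vertex;
  adj_sym : symmetric adj;
  adj_irr : irreflexive adj }.

Definition edges (G : sgraph) : {set {set vertex G}} :=
  [set e | [exists x : vertex G, exists y : vertex G,
              adj x y && (e == [set x; y]%SET)]]%SET.

Definition max_degree (G : sgraph) : nat :=
  \max_(x : vertex G) #|[set y | adj x y]%SET|.

Definition colorable (G : sgraph) (k : nat) : bool :=
  [exists c : {ffun vertex G -> 'I_k},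
     [forall x, forall y, adj x y ==> (c x != c y)]].

Lemma colorable_card (G : sgraph) : exists k, colorable G k.
Proof.
exists #|vertex G|; apply/existsP; exists [ffun x => enum_rank x].
apply/forallP => x; apply/forallP => y; apply/implyP => xy; rewrite !ffunE.
by apply/eqP => /enum_rank_inj exy; move: xy; rewrite exy adj_irr.
Qed.

Definition chromatic_number (G : sgraph) : nat := ex_minn (colorable_card G).

Definition adj_matrix (R : realType) (G : sgraph) : 'M[R]_#|vertex G| :=
  \matrix_(i, j) (adj (enum_val i) (enum_val j))%:R.

(* The spectrum is a finite set, nonempty as soon as G has a vertex (the matrix
   is real symmetric), so that sup and inf are a maximum and a minimum.  Both
   are 0 for an edgeless graph, and then the ratio lambda_max / - lambda_min is
   0 as 0^-1 = 0; if G has an edge, lambda_min is negative. *)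
Definition lambda_max (R : realType) (G : sgraph) : R :=
  sup [set a : R | eigenvalue (adj_matrix R G) a]%classic.

Definition lambda_min (R : realType) (G : sgraph) : R :=
  inf [set a : R | eigenvalue (adj_matrix R G) a]%classic.

Section Keep.
Variables (G : sgraph) (S : {set {set vertex G}}).

Definition keep_adj : rel (vertex G) :=
  fun x y => adj x y && ([set x; y]%SET \in S).

Lemma keep_adj_sym : symmetric keep_adj.
Proof. by move=> x y; rewrite /keep_adj adj_sym finset.setUC. Qed.

Lemma keep_adj_irr : irreflexive keep_adj.
Proof. by move=> x; rewrite /keep_adj adj_irr. Qed.

Definition keep : sgraph := SGraph keep_adj_sym keep_adj_irr.

End Keep.

(* Probability that G_p satisfies E: G_p is [keep S], where S is the random set
   of kept edges, whose law is the product of Bernoulli(p) over the edges. *)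
Definition prob_Gp (R : realType) (p : R) (G : sgraph) (E : pred sgraph) : R :=
  \sum_(S : {set {set vertex G}} | (S \subset edges G) && E (keep S))
    \prod_(e in edges G) (if e \in S then p else 1 - p).

(* Main.v *)
(* The noise M = A(G_p) - p A(G) has independent centered entries bounded by 1,
   supported on a graph of maximum degree D. Since M >= -C (sqrt D + sqrt (log n))
   with high probability, test vectors transfer both extreme eigenvalues from p A(G)
   to A(G_p), and Hoffman's bound gives the chromatic number.

   To bound M, use E tr M^2k with k >= max(D, log n). Only closed walks that use each
   of their edges at least twice contribute, each at most 1. A vertex that is visited
   for the first time has at most D possible values, and at least D unused values are
   available in the complete graph on r = D + 2k <= 3k vertices; so, up to the factor
   n / r, it suffices to count such walks in that complete graph. If m_xy are the edge
   multiplicities and d_x their sums, the Markov chain with transition probabilities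
   m_xy / d_x gives each walk with these multiplicities the probability
   prod (m_xy / sqrt (d_x d_y))^m_xy, which bounds their number. Since m_xy is never 1,
   the sum over m of the reciprocals is, for fixed d, at most
   k^k prod exp (4 d_x d_y / k) = k^k exp (O(k)), and there are exp (O(k)) possible d.
   Hence E tr M^2k <= n (O(k))^k, and Markov's inequality concludes. *)
Require Import Defs.
From HB Require Import structures.
From mathcomp Require Import all_boot all_order all_algebra.
From mathcomp Require Import all_classical all_reals all_analysis.
From mathcomp Require Import lra ring zify.

Set Implicit Arguments.
Unset Strict Implicit.
Unset Printing Implicit Defensive.

Import Order.TTheory GRing.Theory Num.Theory.
Import numFieldNormedType.Exports.
Local Open Scope classical_set_scope.
Local Open Scope ring_scope.

(** * Words and their shapes *)

Fixpoint words (T : finType) (n : nat) : seq (seq T) :=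
  if n is n'.+1 then [seq rcons s x | s <- words T n', x <- enum T]
  else [:: [::]].
Arguments words : simpl never.

Lemma big_words (A : Type) (idx : A) (op : Monoid.com_law idx) (T : finType)
    (n : nat) (P : pred (seq T)) (F : seq T -> A) :
  \big[op/idx]_(s <- words T n.+1 | P s) F s =
  \big[op/idx]_(s <- words T n) \big[op/idx]_(x | P (rcons s x)) F (rcons s x).
Proof.
rewrite big_mkcond big_allpairs_dep; apply: eq_bigr => s _.
by rewrite big_enum -big_mkcond.
Qed.

Lemma size_words (T : finType) n (s : seq T) : s \in words T n -> size s = n.
Proof.
elim: n s => [|n IH] s; first by rewrite inE => /eqP ->.
by case/allpairsP => -[t x] /= [/IH <- _ ->]; rewrite size_rcons.
Qed.

Definition steps (T : Type) (s : seq T) : seq (T * T) := zip s (behead s).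
Arguments steps : simpl never.

Lemma steps_rcons (T : Type) (s : seq T) x y :
  steps (rcons (rcons s x) y) = rcons (steps (rcons s x)) (x, y).
Proof. by elim: s => // a [|b s] //= IH; rewrite /steps /=; congr cons; exact: IH. Qed.

Lemma size_steps (T : Type) (s : seq T) : size (steps s) = (size s).-1.
Proof. by rewrite size_zip size_behead; case: (size s) => //= k; lia. Qed.

(** Each letter becomes the position of its first occurrence, which encodes the equality pattern of
    the word; a fresh letter contributes the current length. *)
Definition word_shape (T : eqType) (s : seq T) : seq nat := [seq index x s | x <- s].

Lemma word_shape_rcons (T : eqType) (s : seq T) x :
  word_shape (rcons s x) = rcons (word_shape s) (index x s).
Proof.
rewrite /word_shape map_rcons; congr rcons.
  by apply/eq_in_map => y ys; rewrite -cats1 index_cat ys.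
rewrite -cats1 index_cat; case: ifP => // /negbT xs.
by rewrite /= eqxx addn0 memNindex.
Qed.

Lemma undup_map_in (T U : eqType) (f : T -> U) (s : seq T) :
  {in s &, injective f} -> undup (map f s) = map f (undup s).
Proof.
elim: s => //= x s IH inj; rewrite IH; last first.
  by move=> y z ys zs; apply: inj; rewrite inE (ys, zs) orbT.
have -> : (f x \in map f s) = (x \in s).
  apply/mapP/idP => [[y ys]|xs]; last by exists x.
  by move/inj => ->//; rewrite !inE ?eqxx ?ys ?orbT.
by case: ifP.
Qed.

Lemma index_inj_in (T : eqType) (s : seq T) : {in s &, injective (index^~ s)}.
Proof. by move=> x y xs ys /= /index_inj -> //. Qed.

(** A repeated last letter is determined by its index, while all fresh last letters give the same
    shape. *)
Lemma sum_word_shape_rcons (T : finType) (s : seq T) (Q : pred T) (phi : seq nat -> nat) :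
  (\sum_(x | Q x) phi (word_shape (rcons s x)) =
   \sum_(x <- undup s | Q x) phi (rcons (word_shape s) (index x s)) +
   #|[pred x | Q x & x \notin s]| * phi (rcons (word_shape s) (size (word_shape s))))%N.
Proof.
rewrite (bigID (mem s)) /=; congr addn.
  rewrite -[RHS]big_filter big_uniq ?filter_uniq ?undup_uniq //=.
  apply: eq_big => x; first by rewrite mem_filter mem_undup.
  by rewrite word_shape_rcons.
rewrite -sum1_card big_distrl /=; apply: eq_big => [x|x /andP[_ xs]] //.
by rewrite mul1n word_shape_rcons size_map memNindex.
Qed.

(* The statement is generalized over phi so that the last letter can be absorbed
   into phi: it is either determined by the shape or fresh, with at most D choices
   in T and at least D choices in U. *)
Lemma word_shape_comparison (T U : finType) (e : rel T) (D n : nat)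
    (phi : seq nat -> nat) :
  (forall x, #|[pred y | e x y]| <= D)%N -> (D + n <= #|U|)%N ->
  (#|U| * \sum_(s <- words T n.+1 | all (fun p => e p.1 p.2) (steps s))
            phi (word_shape s) <=
   #|T| * \sum_(s <- words U n.+1) phi (word_shape s))%N.
Proof.
move=> degD; elim: n phi => [|n IH] phi DU.
  have k0 (V : finType) : (\sum_(x : V) phi (word_shape (rcons [::] x)) = #|V| * phi [:: 0])%N.
    under eq_bigr => x _ do rewrite /word_shape /= eqxx.
    by rewrite sum_nat_const.
  by rewrite !big_words !big_seq1 /steps /= !k0 mulnCA.
pose psi k := (\sum_(j <- undup k) phi (rcons k j) +
               D * phi (rcons k (size k)))%N.
have sumI (V : finType) (s : seq V) :
   (\sum_(x <- undup s) phi (rcons (word_shape s) (index x s)) =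
    \sum_(j <- undup (word_shape s)) phi (rcons (word_shape s) j))%N.
  by rewrite undup_map_in ?big_map //; exact: index_inj_in.
apply: (@leq_trans (#|U| * \sum_(s <- words T n.+1 |
    all (fun p => e p.1 p.2) (steps s)) psi (word_shape s))); last first.
  apply: (leq_trans (IH _ _)); first by lia.
  rewrite leq_mul2l; apply/orP; right.
  rewrite [leqRHS]big_words /= big_seq [leqRHS]big_seq.
  apply: leq_sum => s /size_words ss; rewrite sum_word_shape_rcons sumI leq_add2l.
  rewrite leq_mul2r; apply/orP; right.
  (* At most [n.+1] letters of [U] are used, so at least [D] are still fresh. *)
  have cs : (#|s| <= n.+1)%N by rewrite -ss card_size.
  rewrite (@eq_card _ _ (predC (mem s))) => [|x]; last by rewrite !inE.
  by rewrite -(leq_add2l #|s|) cardC (leq_trans _ DU) // addnC leq_add2l.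
rewrite leq_mul2l; apply/orP; right.
rewrite big_words big_seq [leqRHS]big_seq_cond [leqRHS]big_mkcondr /=.
apply: leq_sum => s /size_words; case/lastP: s => // s z _.
under eq_bigl => x do rewrite steps_rcons all_rcons /=.
case: ifP => sp; last by rewrite big_pred0 // => x; rewrite andbF.
rewrite (eq_bigl (e z)); last by move=> x; rewrite andbT.
rewrite sum_word_shape_rcons /psi; apply: leq_add.
  by rewrite -sumI big_mkcond; apply: leq_sum => x _; case: ifP.
rewrite leq_mul2r; apply/orP; right.
(* In [T] a fresh letter must also be a neighbour of [z]. *)
apply: leq_trans (degD z); apply: subset_leq_card.
by apply/fintype.subsetP => x; rewrite !inE => /andP[].
Qed.

(** * Closed walks in the complete graph *)

Definition closed_walk (T : eqType) (s : seq T) : bool :=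
  if s is x :: s' then last x s' == x else false.

Definition same_edge (T : eqType) (p q : T * T) : bool :=
  (q == p) || (q == (p.2, p.1)).

Definition edge_mult (T : eqType) (s : seq T) (p : T * T) : nat :=
  count (same_edge p) (steps s).

(** Other walks have expectation zero: a loop meets a zero diagonal entry, and an edge used once
    contributes a centered factor. *)
Definition good_walk (T : eqType) (s : seq T) : bool :=
  all (fun p => (p.1 != p.2) && (2 <= edge_mult s p)%N) (steps s).

Lemma prod_count (R : comNzRingType) (J : Type) (I : finType) (l : seq J) (f : J -> I)
    (P : pred I) (h : I -> R) :
  all (fun p => P (f p)) l ->
  \prod_(p <- l) h (f p) = \prod_(q | P q) h q ^+ count (fun p => f p == q) l.
Proof.
elim: l => [|p l IH] /=; first by rewrite big_nil big1.
case/andP=> Pp /IH{}IH; rewrite big_cons IH (bigD1 (f p)) //=.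
rewrite [RHS](bigD1 (f p)) //= eqxx exprS mulrA; congr (_ * _).
by apply: eq_bigr => q /andP[_ /negPf]; rewrite eq_sym => ->.
Qed.

Section Counting.
Variable R : realType.

(** From each of the [#|T|] starting points the walks have total probability at most 1: summing over
    the last letter removes the last step. *)
Lemma sum_walks_substochastic (T : finType) (Q : T * T -> R) n :
  (forall p, 0 <= Q p) -> (forall x, \sum_y Q (x, y) <= 1) ->
  \sum_(s <- words T n.+1) \prod_(p <- steps s) Q p <= #|T|%:R.
Proof.
move=> Q0 Q1; elim: n => [|n IH].
  rewrite big_words big_seq1 /steps /=.
  under eq_bigr do rewrite big_nil.
  by rewrite sumr_const.
rewrite big_words /=; apply: le_trans IH.
rewrite big_seq [leRHS]big_seq; apply: ler_sum => s /size_words.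
case/lastP: s => // s z _.
under eq_bigr do rewrite steps_rcons big_rcons /=.
by rewrite -mulr_sumr ler_piMr ?prodr_ge0.
Qed.

Lemma sum_half n : \sum_(j < n) 2^-1 ^+ j <= 2 :> R.
Proof.
suff -> : \sum_(j < n) 2^-1 ^+ j = 2 - 2 * 2^-1 ^+ n :> R.
  by rewrite gerBl mulr_ge0 // exprn_ge0.
elim: n => [|n IH]; first by rewrite big_ord0 expr0; lra.
by rewrite big_ord_recr /= IH exprS; lra.
Qed.

(** Excluding [j = 1] removes the term linear in [t], which is why the exponent can be quadratic in
    [t] near 0. *)
Lemma sum_pow_self_le n (t : R) : 0 <= t ->
  \sum_(j < n | j != 1%N :> nat) (t / j%:R) ^+ j <= expR (4 * t ^+ 2).
Proof.
move=> t0.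
(* The leading 1 accounts for [j = 0]; the terms from [j = 2] on are compared with a geometric
   series. *)
have main c : 0 <= c -> (forall j, (2 <= j)%N -> (t / j%:R) ^+ j <= c * 2^-1 ^+ j) ->
    \sum_(j < n | j != 1%N :> nat) (t / j%:R) ^+ j <= 1 + 2 * c.
  move=> c0 Hc.
  apply: (@le_trans _ _ (\sum_(j < n) ((j == 0%N :> nat)%:R + c * 2^-1 ^+ j))).
    rewrite big_mkcond; apply: ler_sum => -[[|[|j]] ?] _ /=.
    - by rewrite expr0 mulr1 lerDl.
    - by rewrite add0r mulr_ge0 // exprn_ge0.
    - by rewrite add0r Hc.
  rewrite big_split /= -mulr_sumr; apply: lerD.
    case: n => [|n]; first by rewrite big_ord0.
    by rewrite big_ord_recl big1 ?addr0.
  by rewrite mulrC ler_wpM2r // sum_half.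
have pw j : (2 <= j)%N -> 2 ^+ j <= j%:R ^+ j :> R.
  by move=> j2; rewrite lerXn2r ?nnegrE ?ler0n // ler_nat.
have [t1|t1] := leP t 1.
  apply: le_trans (main (t ^+ 2) _ _) _; first exact: sqr_ge0.
    move=> j j2; rewrite expr_div_n exprVn.
    apply: ler_pM; rewrite ?exprn_ge0 ?invr_ge0 ?exprn_ge0 //.
      by rewrite ler_wiXn2l.
    by rewrite lef_pV2 ?posrE ?exprn_gt0 ?ltr0n ?(ltn_trans _ j2) ?pw.
  apply: le_trans (expR_ge1Dx _); have := sqr_ge0 t; lra.
apply: le_trans (main (expR (2 * t)) _ _) _; first exact: expR_ge0.
  move=> j j2; have j0 : 0 < j%:R :> R by rewrite ltr0n (ltn_trans _ j2).
  have -> : (t / j%:R) ^+ j = (2 * t / j%:R) ^+ j * 2^-1 ^+ j.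
    by rewrite -exprMn; congr (_ ^+ _); lra.
  rewrite ler_wpM2r ?exprn_ge0 //.
  (* The bound [x <= expR x] at [x = 2 t / j], raised to the power [j], gives
     [(2 t / j) ^+ j <= expR (2 t)]. *)
  have -> : expR (2 * t) = expR (2 * t / j%:R) ^+ j.
    by rewrite -expRM_natl; congr expR; field; rewrite gt_eqF.
  have tj : 0 <= 2 * t / j%:R by rewrite divr_ge0 ?mulr_ge0 ?ler0n.
  rewrite lerXn2r ?nnegrE ?expR_ge0 //.
  by apply: le_trans (expR_ge1Dx _); rewrite lerDr.
(* Since [expR 2 >= 3], the leading 1 is absorbed; then [2 + 2 t <= 4 t ^+ 2] for [t >= 1]. *)
apply: (@le_trans _ _ (expR 2 * expR (2 * t))).
  have e2 := expR_ge1Dx (2 : R); have et := expR_ge1Dx (2 * t).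
  have : 0 <= (expR 2 - 3) * expR (2 * t) by rewrite mulr_ge0 ?expR_ge0 //; lra.
  rewrite mulrBl; lra.
rewrite -expRD ler_expR.
have : 0 <= (t - 1) ^+ 2 by exact: sqr_ge0.
rewrite sqrrB expr1n mulr1; have : 0 <= (t - 1) * t by rewrite mulr_ge0 //; lra.
rewrite mulrBl mul1r -expr2; lra.
Qed.

End Counting.

Lemma size_count (J : Type) (I : finType) (l : seq J) (f : J -> I) (P : pred I) :
  all (fun p => P (f p)) l ->
  size l = (\sum_(q | P q) count (fun p => f p == q) l)%N.
Proof.
elim: l => [|p l IH] /=; first by rewrite big1.
case/andP=> Pp /IH{}IH; rewrite big_split /= -IH (bigD1 (f p)) //= eqxx.
by rewrite big1 ?addn0 // => q /andP[_ /negPf]; rewrite eq_sym => ->.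
Qed.

Lemma steps_cons (T : Type) (x y : T) s : steps [:: x, y & s] = (x, y) :: steps (y :: s).
Proof. by []. Qed.

Lemma unzip_steps (T : Type) (x : T) s :
  unzip1 (steps (x :: s)) = belast x s /\ unzip2 (steps (x :: s)) = s.
Proof.
elim: s x => [|y s IH] x //; rewrite steps_cons /=.
by have [e1 e2] := IH y; split; congr cons.
Qed.

(** A closed walk leaves each vertex as often as it enters it. *)
Lemma closed_walk_prod (R : comNzRingType) (T : eqType) (s : seq T) (g : T -> R) :
  closed_walk s -> \prod_(p <- steps s) g p.1 = \prod_(p <- steps s) g p.2.
Proof.
case: s => [//|x s] /eqP xs.
rewrite -(big_map fst predT g) -(big_map snd predT g).
have [] := unzip_steps x s; rewrite /unzip1 /unzip2 => -> ->; apply: perm_big.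
by rewrite -(perm_cons x) -{1}xs -perm_rcons -lastI.
Qed.

Lemma edge_mult_sym (T : eqType) (s : seq T) x y : edge_mult s (x, y) = edge_mult s (y, x).
Proof. by apply: eq_count => q; rewrite /same_edge orbC. Qed.

Lemma edge_mult_same (T : eqType) (s : seq T) p q :
  same_edge p q -> edge_mult s q = edge_mult s p.
Proof.
case: p => x y /orP[/eqP->//|/eqP->]; exact: edge_mult_sym.
Qed.

Lemma edge_mult_size (T : eqType) (s : seq T) p : (edge_mult s p <= (size s).-1)%N.
Proof. by rewrite -size_steps count_size. Qed.

(** * Walks with prescribed edge multiplicities *)

Section WalkCounts.
Variables (R : realType) (r L : nat).
Implicit Types (m : {ffun 'I_r * 'I_r -> 'I_L.+1}) (p q : 'I_r * 'I_r).

(** Multiplicities are stored at pairs [x < y] only; this is their symmetric extension, zero on the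
    diagonal. *)
Definition mult m p : nat :=
  if (p.1 < p.2)%N then nat_of_ord (m p) else if (p.2 < p.1)%N then nat_of_ord (m (p.2, p.1)) else 0%N.

Definition mdeg m x : nat := (\sum_y mult m (x, y))%N.

(** Zero entries off the upper triangle make the encoding of multiplicities unique. *)
Definition admissible m : bool :=
  [forall q : 'I_r * 'I_r,
     if (q.1 < q.2)%N then m q != 1%N :> nat else m q == 0%N :> nat].

Definition valid_counts m : bool := admissible m && (\sum_q m q == L :> nat)%N.

(* Reciprocal of the probability that [transition m] gives to a closed walk
   with multiplicities m. *)
Definition weight m : R :=
  \prod_(q : 'I_r * 'I_r | (q.1 < q.2)%N)
    (Num.sqrt ((mdeg m q.1)%:R * (mdeg m q.2)%:R) / (m q)%:R) ^+ m q.

Definition transition m p : R := (mult m p)%:R / (mdeg m p.1)%:R.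

Definition walk_counts (s : seq 'I_r) : {ffun 'I_r * 'I_r -> 'I_L.+1} :=
  [ffun q : 'I_r * 'I_r => if (q.1 < q.2)%N then inord (edge_mult s q) else ord0].

Definition sort_pair p := if (p.1 < p.2)%N then p else (p.2, p.1).

Lemma weight_ge0 m : 0 <= weight m.
Proof. by apply: prodr_ge0 => q _; rewrite exprn_ge0 ?divr_ge0 ?sqrtr_ge0. Qed.

Lemma transition_ge0 m p : 0 <= transition m p.
Proof. by rewrite divr_ge0. Qed.

Lemma sum_transition_le1 m x : \sum_y transition m (x, y) <= 1.
Proof.
rewrite /transition /= -mulr_suml -natr_sum -/(mdeg m x).
have [->|d0] := eqVneq (mdeg m x) 0%N; first by rewrite mul0r.
by rewrite divff // pnatr_eq0.
Qed.

Lemma mult_sym m x y : mult m (x, y) = mult m (y, x).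
Proof. by rewrite /mult /=; case: ltngtP. Qed.

Lemma sort_pair_lt p : p.1 != p.2 -> ((sort_pair p).1 < (sort_pair p).2)%N.
Proof.
rewrite /sort_pair => ne; case: ifP => //= /negbT; rewrite -leqNgt leq_eqVlt.
by case/orP => // /eqP/val_inj e; rewrite e eqxx in ne.
Qed.

Section Walk.
Variable s : seq 'I_r.
Hypotheses (size_s : size s = L.+1) (good_s : good_walk s).

Lemma walk_countsE q : (q.1 < q.2)%N -> walk_counts s q = edge_mult s q :> nat.
Proof.
move=> q12; rewrite ffunE q12 inordK // ltnS.
by apply: leq_trans (edge_mult_size _ _) _; rewrite size_s.
Qed.

Lemma steps_neq p : p \in steps s -> p.1 != p.2.
Proof. by move/(allP good_s)/andP => []. Qed.

Lemma count_sort_pair q : (q.1 < q.2)%N ->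
  count (fun p => sort_pair p == q) (steps s) = edge_mult s q.
Proof.
case: q => x y /= xy; apply: eq_in_count => -[a b] /steps_neq /= ab.
rewrite /same_edge /sort_pair /= !xpair_eqE /=.
case: ltngtP => [lt|lt|/val_inj e]; last by rewrite e eqxx in ab.
  by rewrite !xpair_eqE -!val_eqE /=; lia.
by rewrite !xpair_eqE -!val_eqE /=; lia.
Qed.

Lemma valid_walk_counts : valid_counts (walk_counts s).
Proof.
apply/andP; split; last first.
  rewrite (bigID (fun q : 'I_r * 'I_r => q.1 < q.2)%N) /= [X in (_ + X)%N]big1 => [|q]; last first.
    by rewrite ffunE => /negPf ->.
  rewrite addn0 (eq_bigr (fun q => count (fun p => sort_pair p == q) (steps s))); last first.
    by move=> q q12; rewrite walk_countsE ?count_sort_pair.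
  rewrite -(size_count (f := sort_pair)) ?size_steps ?size_s //.
  by apply/allP => p /steps_neq; exact: sort_pair_lt.
apply/forallP => q; case: ifP => q12; last by rewrite ffunE q12.
rewrite walk_countsE //; apply/eqP => e1.
have : has (same_edge q) (steps s) by rewrite has_count -/(edge_mult s q) e1.
case/hasP => q' /(allP good_s)/andP[_]; rewrite leqNgt => /negP ng sq; apply: ng.
by rewrite (edge_mult_same _ sq) e1.
Qed.

(** Closedness turns the degrees of the starting points into the symmetric [Num.sqrt (d x * d y)],
    so the product can be grouped by undirected edges, where it is the inverse of the weight. *)
Lemma prod_transition_weight : closed_walk s ->
  (\prod_(p <- steps s) transition (walk_counts s) p) * weight (walk_counts s) = 1.
Proof.
set m := walk_counts s => cs.
pose d x : R := (mdeg m x)%:R.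
pose h q := (m q)%:R / Num.sqrt (d q.1 * d q.2).
have -> : \prod_(p <- steps s) transition m p = \prod_(p <- steps s) h (sort_pair p).
  rewrite /transition prodf_div.
  have -> : \prod_(p <- steps s) (mdeg m p.1)%:R =
            \prod_(p <- steps s) Num.sqrt (d p.1 * d p.2).
    under [RHS]eq_bigr do rewrite sqrtrM ?ler0n //.
    rewrite big_split /= -(closed_walk_prod (fun x => Num.sqrt (d x)) cs) -big_split /=.
    by apply: eq_bigr => p _; rewrite -expr2 sqr_sqrtr ?ler0n.
  rewrite -prodf_div big_seq [RHS]big_seq; apply: eq_bigr => -[x y] /steps_neq /= xy.
  rewrite /h /sort_pair /mult /=; case: ltngtP => [lt|lt|/val_inj e] //=.
    by rewrite [d x * _]mulrC.
  by rewrite e eqxx in xy.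
rewrite (prod_count (P := fun q => q.1 < q.2)%N); last first.
  by apply/allP => p /steps_neq; exact: sort_pair_lt.
rewrite /weight -big_split /= big1 // => q q12.
rewrite count_sort_pair // -walk_countsE // -/m -exprMn.
have [->|m0] := eqVneq (m q : nat) 0%N; first by rewrite expr0.
(* Positive multiplicity forces positive degrees at both endpoints, so the two factors really
   cancel. *)
have dpos x y : mult m (x, y) != 0%N -> mdeg m x != 0%N.
  by apply: contraNN => /eqP; rewrite /mdeg => /eqP; rewrite sum_nat_eq0 => /forallP/(_ y).
have mq : mult m q != 0%N by rewrite /mult q12.
rewrite /h /d mulf_div [X in _ / X]mulrC divff ?expr1n // mulf_neq0 ?pnatr_eq0 //.
rewrite sqrtr_eq0 -ltNge mulr_gt0 // ltr0n lt0n.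
  by apply: (dpos _ q.2); rewrite -surjective_pairing.
by apply: (dpos _ q.1); rewrite mult_sym -surjective_pairing.
Qed.

End Walk.

(** For its own multiplicities each good closed walk has transition product times weight equal to 1;
    after exchanging the sums, each [m] costs at most [r] times its weight. *)
Lemma count_walks_le :
  (\sum_(s <- words 'I_r L.+1) (closed_walk s && good_walk s))%:R <=
  r%:R * \sum_(m | valid_counts m) weight m.
Proof.
rewrite natr_sum.
apply: (@le_trans _ _ (\sum_(s <- words 'I_r L.+1) \sum_(m | valid_counts m)
    (\prod_(p <- steps s) transition m p) * weight m)).
  rewrite big_seq [leRHS]big_seq; apply: ler_sum => s /size_words ss.
  have pos m : 0 <= (\prod_(p <- steps s) transition m p) * weight m.
    by rewrite mulr_ge0 ?weight_ge0 // prodr_ge0 // => p _; exact: transition_ge0.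
  case: (boolP (closed_walk s && good_walk s)) => [/andP[cs gs]|_]; last exact: sumr_ge0.
  rewrite (bigD1 (walk_counts s)) ?valid_walk_counts //= prod_transition_weight //.
  by rewrite lerDl sumr_ge0.
rewrite exchange_big mulr_sumr; apply: ler_sum => m _.
rewrite -mulr_suml ler_wpM2r ?weight_ge0 //.
apply: le_trans (sum_walks_substochastic _ _ _) _.
- exact: transition_ge0.
- exact: sum_transition_le1.
- by rewrite card_ord.
Qed.

End WalkCounts.

(** * Summing the weights over all multiplicities *)

Section WeightSum.
Variables (R : realType) (r k : nat).
Hypothesis k_gt0 : (0 < k)%N.
Let L := k.*2.
Implicit Types (m : {ffun 'I_r * 'I_r -> 'I_L.+1}) (d : {ffun 'I_r -> 'I_(L.*2).+1}).

(** Handshake: each edge is counted at both endpoints. *)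
Lemma sum_mdeg m : valid_counts m -> (\sum_x mdeg m x = L.*2)%N.
Proof.
case/andP=> /forallP adm /eqP sm.
rewrite /mdeg pair_big /=.
transitivity (\sum_(p : 'I_r * 'I_r) (m p + m (p.2, p.1)))%N.
  apply: eq_bigr => -[x y] _; rewrite /mult /=.
  have := adm (x, y); have := adm (y, x); rewrite /=.
  by case: (ltngtP x y) => [_ /eqP -> _|_ _ /eqP ->|_ /eqP -> /eqP ->]; rewrite ?addn0.
rewrite big_split /= sm -addnn; congr addn; apply: etrans sm.
have swK : involutive (fun p : 'I_r * 'I_r => (p.2, p.1)) by case.
by rewrite [RHS](reindex_inj (inv_inj swK)).
Qed.

Definition degs m : {ffun 'I_r -> 'I_(L.*2).+1} := [ffun x => inord (mdeg m x)].

Lemma degsE m x : valid_counts m -> degs m x = mdeg m x :> nat.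
Proof.
by move=> vm; rewrite ffunE inordK // ltnS -(sum_mdeg vm) (bigD1 x) //= leq_addr.
Qed.

(** For fixed degrees the weight is a product over pairs. Once the constraints on the total and on
    the degrees are dropped, the sum over [m] becomes a product of one-variable sums, bounded by
    [sum_pow_self_le]. *)
Lemma sum_weight_degs d : (\sum_x d x = L.*2)%N ->
  \sum_(m | valid_counts m && (degs m == d)) weight R m <=
  k%:R ^+ k * expR (64 * k%:R).
Proof.
move=> sd.
have k0 : 0 < k%:R :> R by rewrite ltr0n.
(* The factor [k ^+ k] is spread over the [2 k] steps as powers of [sqrt k], whence the division by
   [k]. *)
pose t (q : 'I_r * 'I_r) : R := Num.sqrt ((d q.1)%:R * (d q.2)%:R / k%:R).
pose F q (j : 'I_L.+1) : R := (t q / j%:R) ^+ j.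
pose ok (q : 'I_r * 'I_r) (j : 'I_L.+1) :=
  if (q.1 < q.2)%N then j != 1%N :> nat else j == 0%N :> nat.
have F0 q j : 0 <= F q j by rewrite exprn_ge0 ?divr_ge0 ?sqrtr_ge0.
apply: (@le_trans _ _ (k%:R ^+ k * \sum_(m in family ok) \prod_q F q (m q))).
  rewrite mulr_sumr [leRHS]big_mkcond [leLHS]big_mkcond /=; apply: ler_sum => m _.
  case: ifP => [/andP[vm /eqP dm]|_]; last first.
    by case: ifP => // _; rewrite mulr_ge0 ?exprn_ge0 ?prodr_ge0 ?ltW.
  have /andP[/forallP adm /eqP sm] := vm.
  have -> : m \in family ok by apply/familyP => q; exact: adm.
  have -> : k%:R ^+ k = \prod_q (Num.sqrt k%:R) ^+ m q :> R.
    by rewrite prodrXr sm /L -mul2n exprM sqr_sqrtr // ltW.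
  rewrite -big_split /= [leRHS](bigID (fun q : 'I_r * 'I_r => q.1 < q.2)%N) /=.
  rewrite [X in _ <= _ * X]big1 => [|q /negPf q12]; last first.
    by have := adm q; rewrite q12 /F => /eqP ->; rewrite !expr0 mulr1.
  rewrite mulr1 /weight le_eqVlt; apply/orP; left; apply/eqP.
  apply: eq_bigr => q _; rewrite /F /t -exprMn -dm !degsE //; congr (_ ^+ _).
  rewrite mulrA -sqrtrM ?ler0n //; congr (Num.sqrt _ / _).
  by rewrite [RHS]mulrC divfK // gt_eqF.
rewrite ler_wpM2l ?exprn_ge0 ?ler0n // -(bigA_distr_big_dep ok F) /=.
apply: (@le_trans _ _ (\prod_q expR (4 * t q ^+ 2))).
  apply: ler_prod => q _; rewrite sumr_ge0 //=.
  apply: le_trans (sum_pow_self_le L.+1 (sqrtr_ge0 _)).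
  rewrite [leLHS]big_mkcond [leRHS]big_mkcond; apply: ler_sum => j _ /=.
  rewrite /ok; case: (q.1 < q.2)%N; first exact: lexx.
  case: (eqVneq (j : nat) 0%N) => [j0|_].
    by have -> : (j != 1%N :> nat) by rewrite j0.
  by case: ifP => // _; exact: F0.
rewrite -expR_sum ler_expR -mulr_sumr.
have -> : \sum_q t q ^+ 2 = (\sum_x (d x)%:R) * (\sum_x (d x)%:R) / k%:R.
  rewrite big_distrlr /= pair_big mulr_suml; apply: eq_bigr => q _.
  by rewrite sqr_sqrtr // mulr_ge0 ?mulr_ge0 ?invr_ge0 ?ltW.
(* The degrees sum to [4 k], so the exponent is [4 (4 k)^2 / k = 64 k]. *)
rewrite -natr_sum sd /L -!mul2n !natrM.
by rewrite le_eqVlt; apply/orP; left; apply/eqP; field; rewrite gt_eqF.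
Qed.

(** Weigh [d] by [2^-1] to the sum of its entries: each counted [d] has weight [2^-(4 k)], and by
    geometric series all weights add up to at most [2^r]. *)
Lemma count_degs :
  \sum_(d : {ffun 'I_r -> 'I_(L.*2).+1} | (\sum_x d x == L.*2)%N) 1 <= 2 ^+ (k * 4 + r) :> R.
Proof.
apply: (@le_trans _ _ (2 ^+ (k * 4) * \sum_(d : {ffun 'I_r -> 'I_(L.*2).+1}) \prod_x 2^-1 ^+ d x)).
  rewrite mulr_sumr big_mkcond; apply: ler_sum => d _; case: ifP => [/eqP sd|_].
    rewrite prodrXr sd /L -!mul2n mulnA mulnC exprVn divff //.
  by rewrite mulr_ge0 ?exprn_ge0 // prodr_ge0 // => x _; rewrite exprn_ge0.
rewrite exprD ler_wpM2l ?exprn_ge0 //.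
rewrite -(bigA_distr_bigA (fun _ (j : 'I_(L.*2).+1) => 2^-1 ^+ j)).
rewrite prodr_const card_ord lerXn2r ?nnegrE ?sum_half //.
by rewrite sumr_ge0 // => j _; rewrite exprn_ge0.
Qed.

Lemma sum_weight_le :
  \sum_(m : {ffun 'I_r * 'I_r -> 'I_L.+1} | valid_counts m) weight R m <=
  2 ^+ (k * 4 + r) * (k%:R ^+ k * expR (64 * k%:R)).
Proof.
rewrite (partition_big degs (fun d => \sum_x d x == L.*2)%N) => [|m vm]; last first.
  by apply/eqP; apply: etrans (sum_mdeg vm); apply: eq_bigr => x _; rewrite degsE.
apply: (@le_trans _ _ (\sum_(d : {ffun 'I_r -> 'I_(L.*2).+1} | (\sum_x d x == L.*2)%N) 1 *
    (k%:R ^+ k * expR (64 * k%:R)))).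
  by apply: ler_sum => d /eqP sd; rewrite mul1r sum_weight_degs.
by rewrite -mulr_suml ler_wpM2r ?mulr_ge0 ?exprn_ge0 ?expR_ge0 ?count_degs.
Qed.

End WeightSum.

(** The power [2 ^+ 7] comes from [4 k + r <= 7 k], and [expR 64] from the sum at fixed degrees. *)
Definition walk_constant (R : realType) : R := 2 ^+ 7 * expR 64.

Lemma count_closed_good_walks (R : realType) (r k : nat) :
  (0 < k)%N -> (r <= 3 * k)%N ->
  (\sum_(s <- words 'I_r (k.*2).+1) (closed_walk s && good_walk s))%:R <=
  r%:R * (walk_constant R * k%:R) ^+ k.
Proof.
move=> k0 rk; apply: le_trans (count_walks_le _ _ _) _.
rewrite ler_wpM2l //; apply: le_trans (sum_weight_le _ _ k0) _.
have -> : (walk_constant R * k%:R) ^+ k = 2 ^+ (7 * k) * (k%:R ^+ k * expR (64 * k%:R)).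
  by rewrite /walk_constant expRM_natr exprM [in LHS]exprMn [in LHS]exprMn mulrAC -mulrA.
rewrite ler_wpM2r ?mulr_ge0 ?exprn_ge0 ?expR_ge0 // ler_weXn2l ?ler1n //.
by lia.
Qed.

(** * Quadratic forms of symmetric matrices *)

Lemma continuous_sum (R : realType) (T : topologicalType) (I : Type) (r : seq I)
    (f : I -> T -> R) :
  (forall i, continuous (f i)) -> continuous (fun x => \sum_(i <- r) f i x).
Proof.
move=> cf; elim: r => [|i r IH] x.
  under eq_fun do rewrite big_nil; exact: cst_continuous.
under eq_fun do rewrite big_cons.
by apply: continuousD; [exact: cf | exact: IH].
Qed.

Section Dot.
Variables (R : realType) (n : nat).
Implicit Types (x y z v : 'rV[R]_n) (A B : 'M[R]_n).

Definition dot x y : R := \sum_i x 0 i * y 0 i.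

Lemma dotC x y : dot x y = dot y x.
Proof. by apply: eq_bigr => i _; rewrite mulrC. Qed.

Lemma dotDl x y z : dot (x + y) z = dot x z + dot y z.
Proof. by rewrite -big_split; apply: eq_bigr => i _ /=; rewrite mxE mulrDl. Qed.

Lemma dotZl a x y : dot (a *: x) y = a * dot x y.
Proof. by rewrite mulr_sumr; apply: eq_bigr => i _; rewrite mxE mulrA. Qed.

Lemma dotDr x y z : dot x (y + z) = dot x y + dot x z.
Proof. by rewrite dotC dotDl !(dotC x). Qed.

Lemma dotZr a x y : dot x (a *: y) = a * dot x y.
Proof. by rewrite dotC dotZl dotC. Qed.

Lemma dot0l x : dot 0 x = 0.
Proof. by rewrite -(scale0r 0) dotZl mul0r. Qed.

Lemma dot_ge0 x : 0 <= dot x x.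
Proof. by apply: sumr_ge0 => i _; rewrite -expr2 sqr_ge0. Qed.

Lemma dot_gt0 x : x != 0 -> 0 < dot x x.
Proof.
move=> x0; rewrite lt_def dot_ge0 andbT; apply: contra_neq x0 => /eqP.
rewrite psumr_eq0 => [/allP x0|i _]; last by rewrite -expr2 sqr_ge0.
apply/rowP => i; rewrite mxE; apply/eqP.
by have := x0 i (mem_index_enum i); rewrite /= -expr2 sqrf_eq0.
Qed.

Lemma dot_trmx A x y : dot (x *m A) y = dot x (y *m A^T).
Proof.
transitivity (\sum_i \sum_j x 0 j * A j i * y 0 i).
  by apply: eq_bigr => i _; rewrite mxE mulr_suml.
rewrite exchange_big; apply: eq_bigr => j _; rewrite mxE mulr_sumr.
by apply: eq_bigr => i _; rewrite mxE; ring.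
Qed.

Lemma cauchy_schwarz x y : dot x y ^+ 2 <= dot x x * dot y y.
Proof.
have [->|y0] := eqVneq y 0.
  by rewrite dotC !dot0l expr0n mulr0.
have py := dot_gt0 y0.
have := dot_ge0 (dot y y *: x + (- dot x y) *: y).
rewrite !(dotDl, dotDr, dotZl, dotZr) (dotC y x) => h.
rewrite -(ler_pM2l py) -subr_ge0.
by apply: le_trans h _; rewrite le_eqVlt; apply/orP; left; apply/eqP; ring.
Qed.

Definition quad A x : R := dot (x *m A) x.

Lemma quadZ A a x : quad A (a *: x) = a ^+ 2 * quad A x.
Proof. by rewrite /quad -scalemxAl dotZl dotZr mulrA. Qed.

Lemma quadD A B x : quad (A + B) x = quad A x + quad B x.
Proof. by rewrite /quad mulmxDr dotDl. Qed.

Lemma quadZl A a x : quad (a *: A) x = a * quad A x.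
Proof. by rewrite /quad -scalemxAr dotZl. Qed.

Lemma quadN A x : quad (- A) x = - quad A x.
Proof. by rewrite -scaleN1r quadZl mulN1r. Qed.

Lemma quad_eigen A x a : x *m A = a *: x -> quad A x = a * dot x x.
Proof. by rewrite /quad => ->; rewrite dotZl. Qed.

Lemma continuous_dot_mulmx A : continuous (fun x => dot (x *m A) x).
Proof.
have -> : (fun x => dot (x *m A) x) = fun x => \sum_i (\sum_j x 0 j * A j i) * x 0 i.
  by apply/funext => x; apply: eq_bigr => i _; rewrite mxE.
apply: continuous_sum => i x; apply: continuousM; last exact: coord_continuous.
apply: continuous_sum => j {}x; apply: continuousM; first exact: coord_continuous.
exact: cst_continuous.
Qed.

Lemma compact_sphere : compact [set x | dot x x = 1].
Proof.
apply: bounded_closed_compact.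
  exists 1; split; first by rewrite num_real.
  move=> M M1 x /= x1; have -> : `|x| = mx_norm x by []. rewrite mx_normrE.
  apply/bigmax_leP; split => [|[i j] _ /=]; first by rewrite ltW // (lt_trans _ M1).
  rewrite ord1; apply: le_trans (ltW M1).
  rewrite -[leRHS]sqrtr1 -x1 -sqrtr_sqr ler_wsqrtr //.
  rewrite /dot (bigD1 j) //= -expr2 lerDl sumr_ge0 // => l _.
  by rewrite -expr2 sqr_ge0.
have -> : [set x | dot x x = 1] = (fun x => dot (x *m 1%:M) x) @^-1` [set 1].
  by apply/seteqP; split => x; rewrite /preimage /= mulmx1.
apply: preimage_closed; last exact: closed_eq.
move=> x _; exact: continuous_dot_mulmx.
Qed.

(** The form attains its maximum on the unit sphere by compactness, and a maximizer is an
    eigenvector: otherwise moving it along its residual would increase the Rayleigh quotient. *)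
Lemma rayleigh A : (0 < n)%N -> A^T = A ->
  exists2 mu, eigenvalue A mu & forall x, quad A x <= mu * dot x x.
Proof.
move=> n0 Asym.
have [||v] := @EVT_max_rV R n (quad A) _ _ compact_sphere.
- exists (delta_mx 0 (Ordinal n0)) => /=.
  rewrite /dot (bigD1 (Ordinal n0)) //= !mxE !eqxx mulr1 big1 ?addr0 // => i ne.
  by rewrite mxE (negPf ne) andbF mul0r.
- by apply: continuous_subspaceT; exact: continuous_dot_mulmx.
rewrite inE /= => v1 vmax.
have dom x : quad A x <= quad A v * dot x x.
  have [->|x0] := eqVneq x 0.
    by rewrite /quad mul0mx !dot0l mulr0.
  have dx := dot_gt0 x0.
  have := vmax ((Num.sqrt (dot x x))^-1 *: x).
  rewrite inE /= dotZl dotZr mulrA -expr2 exprVn sqr_sqrtr ?dot_ge0 //.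
  rewrite mulVf ?gt_eqF // => /(_ erefl); rewrite quadZ exprVn sqr_sqrtr ?dot_ge0 //.
  by rewrite mulrC ler_pdivrMr.
exists (quad A v) => //.
have [mu muE] : exists mu, mu = quad A v by exists (quad A v).
rewrite -muE in dom *; have [u uE] : exists u, u = v *m A - mu *: v by exists (v *m A - mu *: v).
suff u0 : u == 0.
  apply/eigenvalueP; exists v; first by apply/eqP; rewrite -subr_eq0 -uE.
  by apply: contra_eqN v1 => /eqP ->; rewrite dot0l eq_sym oner_eq0.
apply: contraT => /dot_gt0 N0.
pose c := quad A u - mu * dot u u.
(* The coefficient of [2 * t] is [dot (v *m A - mu *: v) u], which is [dot u u] by the choice of
   [u]. *)
have perturb t : 2 * t * dot u u + t ^+ 2 * c <= 0.
  have := dom (v + t *: u).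
  rewrite /quad mulmxDl -scalemxAl !(dotDl, dotDr, dotZl, dotZr) -/(quad A v) -/(quad A u) -muE.
  rewrite v1 [dot (u *m A) v]dot_trmx Asym (dotC u v) (dotC u (v *m A)).
  have -> : dot u u = dot (v *m A) u - mu * dot v u.
    by rewrite {1}uE dotDl -scaleNr dotZl mulNr.
  rewrite /c -subr_ge0 => h; rewrite -oppr_ge0.
  have -> : dot u u = dot (v *m A) u - mu * dot v u.
    by rewrite {1}uE dotDl -scaleNr dotZl mulNr.
  by apply: le_trans h _; rewrite le_eqVlt; apply/orP; left; apply/eqP; ring.
(* Small enough for the linear term to beat the quadratic one; the [+ 1] avoids a zero
   denominator. *)
pose t := dot u u / (`|c| + 1).
have c1 : 0 < `|c| + 1 by rewrite ltr_wpDl.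
have t0 : 0 < t by rewrite divr_gt0.
have tc : t * `|c| <= dot u u.
  by rewrite /t mulrAC ler_pdivrMr // ler_wpM2l ?dot_ge0 // lerDl.
have := perturb t; rewrite expr2 -mulrA mulrCA -mulrA -mulrDr pmulr_rle0 //.
have : - `|c| <= c by rewrite lerNnormlW.
have := ltW t0; nra.
Qed.

(* A symmetric matrix satisfies [a^2k <= ||M^k||_F^2 = tr M^2k] for each eigenvalue a. *)
Lemma eigenvalue_le_trace A a k : A^T = A -> eigenvalue A a ->
  a ^+ k.*2 <= \tr (A ^+ k.*2).
Proof.
move=> Asym /eigenvalueP[v vA /dot_gt0 v0].
have vAk j : v *m A ^+ j = a ^+ j *: v.
  elim: j => [|j IH]; first by rewrite expr0 mulmx1 scale1r.
  by rewrite !exprS [A * _]/(A *m _) mulmxA vA -scalemxAl IH scalerA.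
have Aksym j : (A ^+ j)^T = A ^+ j.
  elim: j => [|j IH]; first by rewrite !expr0 trmx1.
  by rewrite exprS [A * _]/(A *m _) trmx_mul IH Asym -[LHS]/(_ * _) -exprSr exprS.
set B := A ^+ k.
have : dot (v *m B) (v *m B) <= dot v v * \tr (B *m B^T).
  have -> : \tr (B *m B^T) = \sum_j dot (\row_i B i j) (\row_i B i j).
    rewrite /mxtrace exchange_big; apply: eq_bigr => i _; rewrite mxE.
    by apply: eq_bigr => j _; rewrite !mxE.
  (* Cauchy-Schwarz for [v] against each column of [B]. *)
  rewrite mulr_sumr; apply: ler_sum => j _; apply: le_trans (cauchy_schwarz _ _).
  rewrite -expr2 mxE le_eqVlt; apply/orP; left; apply/eqP.
  by congr (_ ^+ 2); apply: eq_bigr => i _; rewrite mxE.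
rewrite vAk dotZl dotZr mulrA -exprD addnn Aksym mulrC ler_pM2l //.
by rewrite -[B *m B]/(B * B) -exprD addnn.
Qed.

End Dot.

Section Spectrum.
Variables (R : realType) (n : nat) (A : 'M[R]_n).
Hypotheses (n_gt0 : (0 < n)%N) (Asym : A^T = A).

Lemma eigenvalue_le_quad B mu a : eigenvalue B a ->
  (forall x : 'rV[R]_n, quad B x <= mu * dot x x) -> a <= mu.
Proof.
move=> /eigenvalueP[v vB /dot_gt0 v0] /(_ v).
by rewrite (quad_eigen vB) ler_pM2r.
Qed.

Lemma sup_eigenvalue (mu := sup [set a | eigenvalue A a]) :
  eigenvalue A mu /\ forall x, quad A x <= mu * dot x x.
Proof.
have [nu eig_nu dom_nu] := rayleigh n_gt0 Asym.
have ubd : ubound [set a | eigenvalue A a] nu.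
  by move=> a /= /eigenvalue_le_quad; apply.
suff -> : mu = nu by [].
apply/eqP; rewrite eq_le; apply/andP; split; first by apply: ge_sup => //; exists nu.
by apply: ub_le_sup => //; exists nu.
Qed.

(** Apply [rayleigh] to [- A], whose spectrum is the opposite one. *)
Lemma inf_eigenvalue (mu := inf [set a | eigenvalue A a]) :
  eigenvalue A mu /\ forall x, mu * dot x x <= quad A x.
Proof.
have NAsym : (- A)^T = - A by rewrite linearN /= Asym.
have [nu eig_nu dom_nu] := rayleigh n_gt0 NAsym.
have dom x : - nu * dot x x <= quad A x.
  by have := dom_nu x; rewrite quadN mulNr lerNl.
have eig : eigenvalue A (- nu).
  case/eigenvalueP: eig_nu => v vA v0; apply/eigenvalueP; exists v => //.
  by apply/eqP; rewrite scaleNr -vA mulmxN opprK.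
have lbd : lbound [set a | eigenvalue A a] (- nu).
  move=> a /= /eigenvalueP[v vA /dot_gt0 v0]; have := dom v.
  by rewrite (quad_eigen vA) ler_pM2r.
suff -> : mu = - nu by [].
apply/eqP; rewrite eq_le; apply/andP; split; first by apply: ge_inf => //; exists (- nu).
by apply: lb_le_inf => //; exists (- nu).
Qed.

End Spectrum.

Lemma quad_delta (R : realType) n (A : 'M[R]_n) i : quad A (delta_mx 0 i) = A i i.
Proof.
rewrite /quad -rowE /dot (bigD1 i) //= !mxE !eqxx mulr1 big1 ?addr0 // => j ji.
by rewrite !mxE (negPf ji) andbF mulr0.
Qed.

Lemma dot_delta (R : realType) n (i : 'I_n) :
  dot (delta_mx 0 i) (delta_mx 0 i : 'rV[R]_n) = 1.
Proof.
rewrite /dot (bigD1 i) //= !mxE !eqxx mulr1 big1 ?addr0 // => j ji.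
by rewrite !mxE (negPf ji) andbF mulr0.
Qed.

(** * Extreme eigenvalues of graphs *)

Section GraphSpectrum.
Variables (R : realType) (G : sgraph).
Let n := #|vertex G|.
Hypothesis n_gt0 : (0 < n)%N.
Let A : 'M[R]_n := adj_matrix R G.

Lemma adj_matrix_sym : A^T = A.
Proof. by apply/matrixP => i j; rewrite !mxE adj_sym. Qed.

Lemma lambda_maxP : eigenvalue A (lambda_max R G) /\
  forall x, quad A x <= lambda_max R G * dot x x.
Proof. exact: sup_eigenvalue n_gt0 adj_matrix_sym. Qed.

Lemma lambda_minP : eigenvalue A (lambda_min R G) /\
  forall x, lambda_min R G * dot x x <= quad A x.
Proof. exact: inf_eigenvalue n_gt0 adj_matrix_sym. Qed.

Lemma lambda_max_ge0 : 0 <= lambda_max R G.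
Proof.
have [_ /(_ (delta_mx 0 (Ordinal n_gt0)))] := lambda_maxP.
by rewrite quad_delta mxE adj_irr dot_delta mulr1.
Qed.

Lemma lambda_min_le0 : lambda_min R G <= 0.
Proof.
have [_ /(_ (delta_mx 0 (Ordinal n_gt0)))] := lambda_minP.
by rewrite quad_delta mxE adj_irr dot_delta mulr1.
Qed.

Lemma chromatic_number_gt0 : (0 < chromatic_number G)%N.
Proof.
rewrite /chromatic_number; case: ex_minnP => -[|//] /existsP[c _] _.
by case: (c (enum_val (Ordinal n_gt0))).
Qed.

(* Hoffman's bound: test the least eigenvalue on the vectors v - k v_i, where v is
   a top eigenvector and v_i its restriction to the i-th of the k colour classes. *)
Lemma hoffman :
  lambda_max R G <= ((chromatic_number G)%:R - 1) * - lambda_min R G.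
Proof.
have k_gt0 := chromatic_number_gt0; move: k_gt0.
rewrite /chromatic_number; case: ex_minnP => k /existsP[c /forallP cP] _ k_gt0.
have [/eigenvalueP[v vA /dot_gt0 N0] _] := lambda_maxP.
have [_ dom] := lambda_minP.
set lam := lambda_max R G in vA *; set mu := lambda_min R G in dom *.
pose cls i : 'rV[R]_n := \row_j if c (enum_val j) == i then v 0 j else 0.
have dcls i : dot v (cls i) = dot (cls i) (cls i).
  by apply: eq_bigr => j _; rewrite !mxE; case: ifP => // _; rewrite mulr0 mul0r.
(* A colour class spans no edge. *)
have qcls i : quad A (cls i) = 0.
  rewrite /quad /dot big1 // => j _; rewrite !mxE; case: ifP => [/eqP cj|]; last by rewrite mulr0.
  rewrite big1 ?mul0r // => l _; rewrite !mxE; case: ifP => [/eqP cl|]; last by rewrite mul0r.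
  have /forallP/(_ (enum_val j)) := cP (enum_val l).
  by rewrite cl cj eqxx implybF => /negPf ->; rewrite mulr0.
have sum_cls : \sum_i dot v (cls i) = dot v v.
  rewrite exchange_big; apply: eq_bigr => j _; rewrite -mulr_sumr; congr (_ * _).
  rewrite (bigD1 (c (enum_val j))) //= mxE eqxx big1 ?addr0 // => i ne.
  by rewrite mxE eq_sym (negPf ne).
have ineq i : mu * (dot v v + (k%:R ^+ 2 - 2 * k%:R) * dot v (cls i)) <=
              lam * dot v v - 2 * k%:R * lam * dot v (cls i).
  have := dom (v + (- k%:R) *: cls i).
  rewrite /quad mulmxDl -scalemxAl !(dotDl, dotDr, dotZl, dotZr).
  rewrite -/(quad A (cls i)) qcls [dot (cls i *m A) v]dot_trmx adj_matrix_sym.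
  rewrite vA dotZr !dotZl (dotC (cls i) v) -dcls => h.
  by apply: le_trans (le_trans h _); rewrite le_eqVlt; apply/orP; left; apply/eqP; ring.
(* With [N = dot v v], the sum over the classes reads [mu * (k - 1) * (k N) <= - lam * (k N)]. *)
have : \sum_(i < k) mu * (dot v v + (k%:R ^+ 2 - 2 * k%:R) * dot v (cls i)) <=
       \sum_(i < k) (lam * dot v v - 2 * k%:R * lam * dot v (cls i)).
  by apply: ler_sum => i _; exact: ineq.
rewrite -mulr_sumr big_split /= -mulr_sumr [leRHS]big_split /= sumrN -!mulr_sumr sum_cls.
rewrite !sumr_const card_ord -(mulr_natl (dot v v)) => h.
have k0 : 0 < k%:R * dot v v by rewrite mulr_gt0 // ltr0n.
rewrite -(ler_pM2l k0) -subr_ge0; move: h; rewrite -subr_ge0 => h.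
by apply: le_trans h _; rewrite le_eqVlt; apply/orP; left; apply/eqP; ring.
Qed.

Lemma lambda_ratio_le_chromatic :
  lambda_max R G / - lambda_min R G + 1 <= (chromatic_number G)%:R.
Proof.
(* If the least eigenvalue is 0, the ratio is 0 by convention and a positive chromatic number
   suffices. *)
rewrite -lerBrDr; have := lambda_min_le0; rewrite le_eqVlt => /orP[/eqP ->|l0].
  by rewrite oppr0 invr0 mulr0 subr_ge0 ler1n chromatic_number_gt0.
by rewrite ler_pdivrMr ?oppr_gt0 // hoffman.
Qed.

End GraphSpectrum.

(** * Transfer of the extreme eigenvalues to a subgraph *)

Section Perturbation.
Variables (R : realType) (G : sgraph) (S : {set {set vertex G}}) (p t : R).
Hypotheses (n_gt0 : (0 < #|vertex G|)%N) (p_gt0 : 0 < p) (t_gt0 : 0 < t).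
Let H := keep S.

Definition deviation : 'M[R]_#|vertex G| := adj_matrix R H - p *: adj_matrix R G.

Hypothesis dev_ge : forall x, - (p * t) * dot x x <= quad deviation x.

Lemma quad_keep x : quad (adj_matrix R H) x =
  quad deviation x + p * quad (adj_matrix R G) x.
Proof. by rewrite -quadZl -quadD subrK. Qed.

(** Test the form of [H] on a top eigenvector of [G]. *)
Lemma lambda_max_keep : p * (lambda_max R G - t) <= lambda_max R H.
Proof.
have [/eigenvalueP[v vA /dot_gt0 N0] _] := lambda_maxP R n_gt0.
have [_ /(_ v)] := @lambda_maxP R H n_gt0.
rewrite quad_keep (quad_eigen vA) => h.
rewrite -(ler_pM2r N0); apply: le_trans h; have := dev_ge v.
rewrite -subr_ge0 => h; rewrite -subr_ge0.
by apply: le_trans h _; rewrite le_eqVlt; apply/orP; left; apply/eqP; ring.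
Qed.

(** Here the test vector is a bottom eigenvector of [H], so the deviation is again needed from below
    only. *)
Lemma lambda_min_keep : - lambda_min R H <= p * (- lambda_min R G + t).
Proof.
have [/eigenvalueP[v vA /dot_gt0 N0] _] := @lambda_minP R H n_gt0.
have [_ /(_ v) h] := lambda_minP R n_gt0.
have := quad_keep v; rewrite (quad_eigen vA) => e.
rewrite -(ler_pM2r N0) mulNr e.
have := dev_ge v; have : 0 <= p * (quad (adj_matrix R G) v - lambda_min R G * dot v v).
  by rewrite mulr_ge0 ?subr_ge0 // ltW.
rewrite -[_ <= quad deviation v]subr_ge0 => h1 h2; rewrite -subr_ge0.
apply: le_trans (addr_ge0 h1 h2) _.
by rewrite le_eqVlt; apply/orP; left; apply/eqP; ring.
Qed.

Lemma ratio_keep :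
  (lambda_max R G - t) / (- lambda_min R G + t) <= lambda_max R H / - lambda_min R H.
Proof.
have d0 : 0 < - lambda_min R G + t.
  by rewrite ltr_wpDl // oppr_ge0 lambda_min_le0.
have a0 : 0 <= lambda_max R H by exact: (@lambda_max_ge0 R H n_gt0).
(* If the least eigenvalue of [H] is 0, Hoffman's bound makes its largest one nonpositive, so
   [lambda_max R G <= t], while the right-hand ratio is 0. *)
have := @lambda_min_le0 R H n_gt0; rewrite le_eqVlt => /orP[/eqP m0|m0].
  rewrite m0 oppr0 invr0 mulr0 pmulr_lle0 ?invr_gt0 //.
  rewrite -(pmulr_rle0 _ p_gt0); apply: le_trans lambda_max_keep _.
  by have := @hoffman R H n_gt0; rewrite m0 oppr0 mulr0.
have b0 : 0 < - lambda_min R H by rewrite oppr_gt0.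
rewrite ler_pdivrMr // mulrAC ler_pdivlMr // -(ler_pM2l p_gt0) mulrA.
(* Both inequalities are multiplied by nonnegative quantities of [H], so the sign of
   [lambda_max R G - t] does not matter. *)
apply: (@le_trans _ _ (lambda_max R H * - lambda_min R H)).
  by rewrite ler_wpM2r ?lambda_max_keep // ltW.
by rewrite mulrCA ler_wpM2l // lambda_min_keep.
Qed.

(** The extra 1 in Hoffman's bound pays for the [- t] absent from the numerator, as [t] is at most
    the denominator. *)
Lemma chromatic_keep :
  lambda_max R G / (- lambda_min R G + t) <= (chromatic_number H)%:R.
Proof.
have d0 : 0 < - lambda_min R G + t.
  by rewrite ltr_wpDl // oppr_ge0 lambda_min_le0.
apply: le_trans (@lambda_ratio_le_chromatic R H n_gt0).
rewrite -lerBlDr; apply: le_trans ratio_keep.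
rewrite -[X in _ - X](divff (lt0r_neq0 d0)) -mulrBl ler_pM2r ?invr_gt0 //.
by have := lambda_min_le0 R n_gt0; lra.
Qed.

End Perturbation.

(** * Moments of the random deviation *)

Lemma set2_eqE (T : finType) (a b x y : T) :
  ([set a; b]%SET == [set x; y]%SET) = same_edge (x, y) (a, b).
Proof.
apply/eqP/orP => [e|[/eqP[-> ->]//|/eqP[-> ->]]]; last by rewrite finset.setUC.
have := set21 x y; have := set22 x y; rewrite -e !inE.
have := set21 a b; have := set22 a b; rewrite e !inE !xpair_eqE !(eq_sym x) !(eq_sym y).
by do 4!case: (_ =P _) => // ?; subst; rewrite ?eqxx; auto.
Qed.

Lemma sum_subset_prod (R : comNzRingType) (T : finType) (A : {set T}) (F H : T -> R) :
  \sum_(S : {set T} | S \subset A) \prod_(e in A) (if e \in S then F e else H e) =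
  \prod_(e in A) (F e + H e).
Proof.
rewrite [RHS]big_mkcond /=.
(* Outside [A] the factor is [0 + 1], so the expansion over all sets keeps only the subsets of
   [A]. *)
rewrite (eq_bigr (fun e => (if e \in A then F e else 0) + (if e \in A then H e else 1))); last first.
  by move=> e _; case: ifP => // _; rewrite add0r.
rewrite bigA_distr /= big_mkcond; apply: eq_bigr => S _.
case: ifP => [SA|/negbT/fintype.subsetPn[e eS eA]]; last first.
  by rewrite (bigD1 e) //= eS (negPf eA) mul0r.
rewrite big_mkcond; apply: eq_bigr => e _.
case: (boolP (e \in S)) => [eS|_]; last by case: ifP.
by move/fintype.subsetP: SA => /(_ e eS) ->.
Qed.

Lemma mem_steps (T : eqType) (s : seq T) p :
  p \in steps s -> p.1 \in s /\ p.2 \in s.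
Proof.
elim: s => [//|x [//|y s] IH]; rewrite steps_cons inE => /orP[/eqP ->|/IH[p1 p2]].
  by rewrite /= !in_cons !eqxx /= orbT.
by split; rewrite in_cons; apply/orP; right.
Qed.

Lemma steps_map (T U : Type) (f : T -> U) (s : seq T) :
  steps (map f s) = [seq (f p.1, f p.2) | p <- steps s].
Proof. by elim: s => [//|x [//|y s] IH]; rewrite /= !steps_cons -IH. Qed.

(** Goodness depends only on the equality pattern, so it can be read off the shape of a word. *)
Lemma good_walk_map (T U : eqType) (f : T -> U) (s : seq T) :
  {in s &, injective f} -> good_walk (map f s) = good_walk s.
Proof.
move=> inj; rewrite /good_walk steps_map all_map; apply: eq_in_all => p /mem_steps[p1 p2] /=.
rewrite (inj_in_eq inj) //; congr (_ && (_ < _)%N).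
rewrite /edge_mult steps_map count_map; apply: eq_in_count => q /mem_steps[q1 q2].
by rewrite /same_edge /= !xpair_eqE /= !(inj_in_eq inj).
Qed.

Lemma closed_walk_map (T U : eqType) (f : T -> U) (s : seq T) :
  {in s &, injective f} -> closed_walk (map f s) = closed_walk s.
Proof.
case: s => // x s inj; rewrite /= last_map (inj_in_eq inj) // ?mem_head //.
exact: mem_last.
Qed.

(** * Traces of matrix powers as sums over closed walks *)

Section TraceWalks.
Variables (R : realType) (n : nat) (M : 'M[R]_n).

Let walk_prod (s : seq 'I_n) : R := \prod_(q <- steps s) M q.1 q.2.

Lemma exprmx_walks L i j :
  (M ^+ L) i j =
  \sum_(s <- words 'I_n L.+1 | (ohead s == Some i) && (last i s == j)) walk_prod s.
Proof.
elim: L j => [|L IH] j.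
  rewrite big_words big_seq1 /= expr0 mxE.
  rewrite (eq_bigl (fun x => (x == i) && (x == j))); last first.
    by move=> x /=; congr (_ && _); apply/eqP/eqP => [[]|->].
  rewrite big_mkcondr /= big_pred1_eq /walk_prod /steps /= big_nil.
  by case: eqP.
rewrite exprSr mxE big_words /=.
transitivity (\sum_(z <- enum 'I_n) \sum_(s <- words 'I_n L.+1 | (ohead s == Some i) && (last i s == z))
    walk_prod s * M z j).
  by rewrite big_enum; apply: eq_bigr => z _; rewrite IH mulr_suml.
rewrite big_enum /= (exchange_big_dep (fun s => ohead s == Some i)) /=; last by move=> z s _ /andP[].
rewrite [RHS]big_seq [LHS]big_seq_cond big_mkcondr /=; apply: eq_bigr => s /size_words.
case/lastP: s => // s z _; have oh x : ohead (rcons (rcons s z) x) = ohead (rcons s z) by case: s.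
under [RHS]eq_bigl => x do rewrite oh last_rcons.
case: ifP => oi /=; last by rewrite big_pred0.
rewrite last_rcons big_pred1_eq /walk_prod.
rewrite [LHS](big_pred1 z) ?steps_rcons ?big_rcons // => x.
by rewrite oi eq_sym.
Qed.

Lemma trace_walks L :
  \tr (M ^+ L) = \sum_(s <- words 'I_n L.+1 | closed_walk s) walk_prod s.
Proof.
rewrite /mxtrace; under eq_bigr do rewrite exprmx_walks.
rewrite (exchange_big_dep predT) //= [RHS]big_mkcond /=.
rewrite big_seq [RHS]big_seq; apply: eq_bigr => s /size_words.
case: s => // x s _; rewrite (eq_bigl (fun i => (i == x) && (last x s == i))); last first.
  by move=> i /=; congr (_ && _); apply/eqP/eqP => [[]|->].
by rewrite big_mkcondr big_pred1_eq.
Qed.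

End TraceWalks.

(** * Expected trace and Markov's inequality *)

Section RandomSubgraph.
Variables (R : realType) (G : sgraph) (p : R).
Hypothesis p01 : 0 < p < 1.
Let n := #|vertex G|.

Let p_ge0 : 0 <= p. Proof. by case/andP: p01 => /ltW. Qed.
Let q_ge0 : 0 <= 1 - p. Proof. by case/andP: p01 => _ /ltW; rewrite subr_ge0. Qed.

Definition gp_weight (S : {set {set vertex G}}) : R :=
  \prod_(e in edges G) (if e \in S then p else 1 - p).

Lemma gp_weight_ge0 S : 0 <= gp_weight S.
Proof. by apply: prodr_ge0 => e _; case: ifP. Qed.

Lemma sum_gp_weight : \sum_(S : {set {set vertex G}} | S \subset edges G) gp_weight S = 1.
Proof.
rewrite (sum_subset_prod (edges G) (fun=> p) (fun=> 1 - p)).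
by rewrite big1 // => e _; rewrite addrC subrK.
Qed.

Definition walk_in (s : seq 'I_n) : bool :=
  all (fun q => adj (enum_val q.1) (enum_val q.2)) (steps s).

Definition edge_of (q : 'I_n * 'I_n) : {set vertex G} :=
  [set enum_val q.1; enum_val q.2]%SET.

Lemma edge_of_in q : adj (enum_val q.1) (enum_val q.2) -> edge_of q \in edges G.
Proof.
move=> a; rewrite inE; apply/existsP; exists (enum_val q.1).
by apply/existsP; exists (enum_val q.2); rewrite a /= eqxx.
Qed.

Lemma count_edge_of s q :
  count (fun q' => edge_of q' == edge_of q) (steps s) = edge_mult s q.
Proof.
apply: eq_count => q'; rewrite set2_eqE /same_edge /= !xpair_eqE !(inj_eq enum_val_inj).
by case: q q' => [a b] [c d].
Qed.

Lemma deviationE (S : {set {set vertex G}}) (q : 'I_n * 'I_n) :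
  adj (enum_val q.1) (enum_val q.2) ->
  deviation S p q.1 q.2 = (edge_of q \in S)%:R - p.
Proof. by move=> a; rewrite !mxE /keep /= /keep_adj /= a mulr1. Qed.

(** This is the [m]-th central moment of a Bernoulli variable, whose deviation from [p] is at most 1
    in absolute value. *)
Lemma centered_moment_le1 m : `|p * (1 - p) ^+ m + (1 - p) * (- p) ^+ m| <= 1.
Proof.
apply: le_trans (ler_normD _ _) _; rewrite !normrM !normrX normrN.
rewrite !ger0_norm //.
apply: (@le_trans _ _ (p * 1 + (1 - p) * 1)); last by rewrite !mulr1 addrC subrK.
by apply: lerD; rewrite ler_wpM2l // exprn_ile1 // ?gerBl //; move: p_ge0 q_ge0; lra.
Qed.

(** By independence the expectation factors over the edges of [G] into central moments; each is at
    most 1, and one of order 1 vanishes. *)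
Lemma expected_walk_le (s : seq 'I_n) :
  \sum_(S : {set {set vertex G}} | S \subset edges G)
    gp_weight S * \prod_(q <- steps s) deviation S p q.1 q.2 <=
  (walk_in s && good_walk s)%:R.
Proof.
case: (boolP (walk_in s)) => [ws|]; last first.
  (* A step outside [G] meets a zero entry of the deviation. *)
  case/allPn => q qs nadj; rewrite big1 //= => S _.
  have d0 : deviation S p q.1 q.2 = 0.
    by rewrite !mxE /= /keep_adj (negPf nadj) mulr0 subr0.
  by rewrite (big_rem q) //= d0 mul0r mulr0.
pose m e := count (fun q => edge_of q == e) (steps s).
have -> : \sum_(S : {set {set vertex G}} | S \subset edges G)
    gp_weight S * \prod_(q <- steps s) deviation S p q.1 q.2 =
    \prod_(e in edges G) (p * (1 - p) ^+ m e + (1 - p) * (- p) ^+ m e).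
  rewrite -sum_subset_prod; apply: eq_bigr => S _.
  have -> : \prod_(q <- steps s) deviation S p q.1 q.2 =
      \prod_(q <- steps s) ((edge_of q \in S)%:R - p).
    rewrite big_seq [RHS]big_seq; apply: eq_bigr => q /(allP ws); exact: deviationE.
  rewrite (prod_count (P := mem (edges G)) (fun e => (e \in S)%:R - p)); last first.
    by apply/allP => q /(allP ws); exact: edge_of_in.
  rewrite -big_split; apply: eq_bigr => e _ /=.
  by case: ifP => _ //; rewrite sub0r.
case: (boolP (good_walk s)) => [_|] /=.
  apply: le_trans (ler_norm _) _; rewrite normr_prod.
  by apply: prodr_ile1 => e _; rewrite normr_ge0 centered_moment_le1.
case/allPn => q qs; have aq := allP ws _ qs.
rewrite negb_and => /orP[/negPn/eqP e|]; first by rewrite e adj_irr in aq.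
rewrite -leqNgt => m1; have {}m1 : m (edge_of q) = 1%N.
  apply/eqP; rewrite /m count_edge_of eqn_leq m1 -has_count.
  by apply/hasP; exists q => //; rewrite /same_edge eqxx.
rewrite (bigD1 (edge_of q)) ?edge_of_in //= m1 !expr1 mulrN [X in X + _]mulrC addrN.
by rewrite mul0r.
Qed.

Lemma expected_trace_le k : (0 < n)%N -> (0 < k)%N -> (max_degree G <= k)%N ->
  \sum_(S : {set {set vertex G}} | S \subset edges G)
    gp_weight S * \tr (deviation S p ^+ k.*2) <=
  n%:R * (walk_constant R * k%:R) ^+ k.
Proof.
(* The smallest alphabet that [word_shape_comparison] allows; it has at most [3 k] letters as
   [max_degree G <= k]. *)
move=> n0 k0 Dk; pose r := (max_degree G + k.*2)%N.
apply: (@le_trans _ _ (\sum_(s <- words 'I_n (k.*2).+1 | walk_in s)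
                        (closed_walk s && good_walk s))%:R).
  under [leLHS]eq_bigr do rewrite trace_walks mulr_sumr.
  rewrite exchange_big /= natr_sum big_mkcond [leRHS]big_mkcond /=.
  apply: ler_sum => s _; case: (boolP (closed_walk s)) => [_|_]; last by case: ifP.
  apply: le_trans (expected_walk_le s) _.
  by case: (walk_in s); case: (good_walk s).
have r0 : (0 < r)%N by rewrite addn_gt0 double_gt0 k0 orbT.
have degD (i : 'I_n) : (#|[pred j : 'I_n | adj (enum_val i) (enum_val j)]| <= max_degree G)%N.
  rewrite -(fintype.card_image enum_val_inj).
  apply: leq_trans (leq_bigmax (enum_val i)); apply: subset_leq_card.
  by apply/fintype.subsetP => y /fintype.imageP[j]; rewrite !inE => a ->.
pose phi (ka : seq nat) : nat := closed_walk ka && good_walk ka.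
have phiE (T : finType) (s : seq T) : phi (word_shape s) = closed_walk s && good_walk s.
  have inj := @index_inj_in _ s.
  by rewrite /phi /word_shape closed_walk_map // good_walk_map.
have := word_shape_comparison phi degD (U := 'I_r) (n := k.*2).
rewrite !card_ord => /(_ (leqnn _)).
under eq_bigr do rewrite phiE; under [X in (_ <= _ * X)%N]eq_bigr do rewrite phiE.
rewrite -(ler_nat R) !natrM => cmp.
(* The factor [r] of the comparison cancels the factor [r] in the count of walks. *)
rewrite -(ler_pM2l (_ : 0 < r%:R :> R)) ?ltr0n //; apply: le_trans cmp _.
rewrite [leRHS]mulrCA ler_wpM2l //; apply: count_closed_good_walks => //.
by rewrite /r; lia.
Qed.

Lemma deviation_sym (S : {set {set vertex G}}) : (deviation S p)^T = deviation S p.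
Proof.
apply/matrixP => i j; rewrite !mxE /= adj_sym.
by rewrite /keep_adj adj_sym finset.setUC.
Qed.

(** The least eigenvalue [a] satisfies [a ^+ k.*2 < tau ^+ k.*2] through the trace, and the exponent
    is even, so [- tau <= a]. *)
Lemma quad_deviation_ge (S : {set {set vertex G}}) (tau : R) k :
  (0 < n)%N -> (0 < k)%N -> 0 <= tau ->
  \tr (deviation S p ^+ k.*2) < tau ^+ k.*2 ->
  forall x, - tau * dot x x <= quad (deviation S p) x.
Proof.
move=> n0 k0 tau0 small x; have Msym := deviation_sym S.
have [eig dom] := inf_eigenvalue n0 Msym.
apply: le_trans (dom x); rewrite ler_wpM2r ?dot_ge0 //.
move: (le_lt_trans (eigenvalue_le_trace k Msym eig) small).
set a := inf _; have -> : a ^+ k.*2 = `|a| ^+ k.*2.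
  by rewrite -mul2n !exprM -normrX ger0_norm // sqr_ge0.
rewrite ltr_pXn2r ?nnegrE ?double_gt0 // => /ltW.
by rewrite ler_norml => /andP[].
Qed.

Lemma trace_deviation_ge0 (S : {set {set vertex G}}) k : (0 < n)%N ->
  0 <= \tr (deviation S p ^+ k.*2).
Proof.
move=> n0; have Msym := deviation_sym S.
have [mu eig _] := rayleigh n0 Msym.
apply: le_trans (eigenvalue_le_trace k Msym eig).
by rewrite -mul2n exprM exprn_ge0 // sqr_ge0.
Qed.

Lemma prob_Gp_le1 (E : pred sgraph) : prob_Gp p G E <= 1.
Proof.
rewrite -sum_gp_weight /prob_Gp big_mkcondr; apply: ler_sum => S _.
by case: ifP => // _; exact: gp_weight_ge0.
Qed.

(** Markov's inequality for the nonnegative trace, which is at least [tau ^+ k.*2] whenever [E]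
    fails. *)
Lemma prob_Gp_ge (E : pred sgraph) (tau : R) k :
  (0 < n)%N -> (0 < k)%N -> (max_degree G <= k)%N -> 0 < tau ->
  (forall S : {set {set vertex G}},
     (forall x, - tau * dot x x <= quad (deviation S p) x) -> E (keep S)) ->
  1 - n%:R * (walk_constant R * k%:R) ^+ k / tau ^+ k.*2 <= prob_Gp p G E.
Proof.
move=> n0 k0 Dk tau0 HE; have t0 : 0 < tau ^+ k.*2 by rewrite exprn_gt0.
rewrite lerBlDl -lerBlDr ler_pdivlMr //.
apply: le_trans (expected_trace_le n0 k0 Dk).
rewrite -sum_gp_weight /prob_Gp big_mkcondr -sumrB mulr_suml /=.
apply: ler_sum => S _; case: (boolP (E (keep S))) => [_|nE].
  by rewrite subrr mul0r mulr_ge0 ?gp_weight_ge0 ?trace_deviation_ge0.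
rewrite subr0 ler_wpM2l ?gp_weight_ge0 // leNgt; apply: contraNN nE.
by move=> /(quad_deviation_ge n0 k0 (ltW tau0)); exact: HE.
Qed.

End RandomSubgraph.

(** * High probability bounds *)

(** The factor 2 comes from [k <= 2 (D + ln n)], and [expR 2] yields [expR (2 k) >= n^2], which
    turns the factor [n] of the expected trace into [n^-1]. *)
Definition deviation_constant (R : realType) : R :=
  Num.sqrt (2 * walk_constant R * expR 2).

Lemma walk_constant_gt0 (R : realType) : 0 < walk_constant R.
Proof. by rewrite mulr_gt0 ?exprn_gt0 ?expR_gt0. Qed.

Lemma deviation_constant_gt0 (R : realType) : 0 < deviation_constant R.
Proof. by rewrite sqrtr_gt0 !mulr_gt0 ?expR_gt0 ?walk_constant_gt0. Qed.

Section HighProbability.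
Variables (R : realType) (G : sgraph) (p : R).
Hypothesis p01 : 0 < p < 1.
Let n : nat := #|vertex G|.
Let error : R := deviation_constant R / p *
  (Num.sqrt (max_degree G)%:R + Num.sqrt (ln n%:R)).
Hypothesis n_large : expR 1 <= n%:R :> R.

Let ln_ge1 : 1 <= ln n%:R :> R.
Proof. by rewrite -[leLHS](expRK 1) ler_ln ?posrE ?expR_gt0 // (lt_le_trans (expR_gt0 1)). Qed.

Let n_gt0 : (0 < n)%N.
Proof. by rewrite -(ltr0n R) (lt_le_trans (expR_gt0 1)). Qed.

Let error_gt0 : 0 < error.
Proof.
have /andP[p0 _] := p01.
rewrite mulr_gt0 ?divr_gt0 ?deviation_constant_gt0 // ltr_wpDl ?sqrtr_ge0 //.
by rewrite sqrtr_gt0 (lt_le_trans ltr01).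
Qed.

Lemma prob_Gp_ge_inv (E : pred sgraph) :
  (forall S : {set {set vertex G}},
     (forall x, - (p * error) * dot x x <= quad (deviation S p) x) -> E (keep S)) ->
  1 - n%:R^-1 <= prob_Gp p G E.
Proof.
move=> HE; have /andP[p0 _] := p01.
have nR0 : 0 < n%:R :> R by rewrite ltr0n.
pose l : R := ln n%:R; pose D : R := (max_degree G)%:R.
have l1 : 1 <= l := ln_ge1.
have D0 : 0 <= D := ler0n _ _.
(* An integer at least both the maximum degree and [ln n]. *)
pose k := (max_degree G + (Num.truncn l).+1)%N.
have k0 : (0 < k)%N by rewrite /k addnS.
have Dk : (max_degree G <= k)%N by rewrite /k leq_addr.
have lk : l <= k%:R.
  have /andP[_ /ltW h] := truncn_itv (le_trans ler01 l1).
  by apply: le_trans h _; rewrite ler_nat /k leq_addl.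
(* Rounding costs at most 1, which [1 <= l] absorbs. *)
have k2 : k%:R <= 2 * (D + l).
  rewrite /k natrD -natr1 -/D.
  have /andP[h _] := truncn_itv (le_trans ler01 l1); lra.
have tau0 : 0 < p * error by rewrite mulr_gt0.
apply: le_trans (prob_Gp_ge p01 n_gt0 k0 Dk tau0 HE).
rewrite lerB // ler_pdivrMr ?exprn_gt0 // [leRHS]mulrC ler_pdivlMr //.
set c := walk_constant R; have c0 : 0 < c := walk_constant_gt0 R.
apply: (@le_trans _ _ ((c * k%:R * expR 2) ^+ k)); last first.
  have cke : 0 <= c * k%:R * expR 2 by rewrite !mulr_ge0 ?expR_ge0 ?ler0n ?(ltW c0).
  rewrite -mul2n exprM lerXn2r ?nnegrE ?sqr_ge0 //.
  have -> : p * error = deviation_constant R * (Num.sqrt D + Num.sqrt l).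
    by rewrite /error; field; rewrite gt_eqF.
  rewrite exprMn sqr_sqrtr; last by rewrite !mulr_ge0 ?expR_ge0 ?ler0n ?(ltW c0).
  apply: (@le_trans _ _ (2 * c * expR 2 * (D + l))).
    have -> : 2 * c * expR 2 * (D + l) = c * expR 2 * (2 * (D + l)) by ring.
    by rewrite mulrAC ler_wpM2l // mulr_ge0 ?expR_ge0 ?ler0n ?(ltW c0).
  rewrite ler_wpM2l ?mulr_ge0 ?expR_ge0 ?ler0n ?(ltW c0) //.
  have l0 : 0 <= l := le_trans ler01 l1.
  have := sqr_sqrtr D0; have := sqr_sqrtr l0.
  have : 0 <= Num.sqrt D * Num.sqrt l by rewrite mulr_ge0 ?sqrtr_ge0.
  by rewrite sqrrD => h -> ->; rewrite addrAC lerDl mulrn_wge0.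
rewrite [leRHS]exprMn -expRM_natr; set X := (c * _) ^+ k.
have X0 : 0 <= X by rewrite exprn_ge0 // mulr_ge0 ?ler0n ?(ltW c0).
have -> : n%:R * X * n%:R = X * (n%:R * n%:R) by ring.
rewrite ler_wpM2l // -[n%:R]lnK ?posrE // -expRD ler_expR -/l; lra.
Qed.

Lemma prob_Gp_ratio : 1 - n%:R^-1 <= prob_Gp p G (fun H : sgraph =>
  (lambda_max R G - error) / (- lambda_min R G + error) <= lambda_max R H / - lambda_min R H).
Proof.
by apply: prob_Gp_ge_inv => S h; have /andP[p0 _] := p01; exact: (ratio_keep n_gt0 p0 error_gt0 h).
Qed.

Lemma prob_Gp_chromatic : 1 - n%:R^-1 <= prob_Gp p G (fun H : sgraph =>
  lambda_max R G / (- lambda_min R G + error) <= (chromatic_number H)%:R).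
Proof.
by apply: prob_Gp_ge_inv => S h; have /andP[p0 _] := p01; exact: (chromatic_keep n_gt0 p0 error_gt0 h).
Qed.

End HighProbability.

Lemma cvg_to_1 (R : realType) (n : nat -> nat) (u : nat -> R) :
  n @ \oo --> \oo -> (forall k, u k <= 1) ->
  (forall k, expR 1 <= (n k)%:R :> R -> 1 - (n k)%:R^-1 <= u k) ->
  u @ \oo --> (1 : R).
Proof.
move=> n_oo u1 un; apply/cvgrPdist_le => e e0.
have ei : 0 < e^-1 by rewrite invr_gt0.
(* From [N] vertices on, both [expR 1 <= n] and [n^-1 <= e] hold. *)
pose N := (Num.truncn (expR 1 + e^-1 : R)).+1.
have N_lt : expR 1 + e^-1 < N%:R.
  by have /andP[] := truncn_itv (addr_ge0 (expR_ge0 (1 : R)) (ltW ei)).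
have /cvgnyPge/(_ N) := n_oo; apply: filterS => k Nk.
have nk : expR 1 + e^-1 <= (n k)%:R by rewrite (le_trans (ltW N_lt)) // ler_nat.
have x0 := expR_gt0 (1 : R).
rewrite ger0_norm ?subr_ge0 ?u1 //.
have /un h : expR 1 <= (n k)%:R :> R by apply: le_trans nk; rewrite lerDl ltW.
have : (n k)%:R^-1 <= e.
  by rewrite -[leRHS]invrK lef_pV2 ?posrE //; lra.
by lra.
Qed.

Theorem theorem1 (R : realType) :
  exists C : R, 0 < C /\
    forall p : R, 0 < p < 1 ->
    forall G : nat -> sgraph,
      (fun k : nat => #|vertex (G k)|) @ \oo --> \oo ->
      ((fun k : nat => prob_Gp p (G k) (fun H : sgraph =>
          (lambda_max R (G k) - C / p *
             (Num.sqrt (max_degree (G k))%:R + Num.sqrt (ln #|vertex (G k)|%:R)))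
          / (- lambda_min R (G k) + C / p *
             (Num.sqrt (max_degree (G k))%:R + Num.sqrt (ln #|vertex (G k)|%:R)))
          <= lambda_max R H / - lambda_min R H)) @ \oo --> (1 : R)) /\
      ((fun k : nat => prob_Gp p (G k) (fun H : sgraph =>
          lambda_max R (G k)
          / (- lambda_min R (G k) + C / p *
             (Num.sqrt (max_degree (G k))%:R + Num.sqrt (ln #|vertex (G k)|%:R)))
          <= (chromatic_number H)%:R)) @ \oo --> (1 : R)).
Proof.
exists (deviation_constant R); split; first exact: deviation_constant_gt0.
move=> p p01 G G_oo; split; apply: (cvg_to_1 G_oo) => k.
- exact: prob_Gp_le1.
- exact: prob_Gp_ratio.
- exact: prob_Gp_le1.
- exact: prob_Gp_chromatic.
Qed.
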